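(* Let $n,r\in\mathbb{N}$ and let $G$ be any $n$-vertex $r$-regular simple graph. Then (a) $\displaystyle i_3(G)+k_3(G)=\binom{n}{3}-(n-2)\frac{nr}{2}+n\binom{r}{2}$; (b) $\displaystyle i_4(G)-k_4(G)=\binom{n}{4}-\binom{n-2}{2}\frac{nr}{2}+(n-3)\left[n\binom{r}{2}-k_3(G)\right]-n\binom{r}{3}+(k_2\uplus k_2)(G)-c_4(G)$. In particular, for fixed $n$ and $r$, all $n$-vertex, $r$-regular, triangle-free graphs have the same number of independent sets of size three, and the number of independent sets of size four in an $n$-vertex, $r$-regular, triangle-free graph $G$ is a function of only $c_4(G)$ and $(k_2\uplus k_2)(G)$ (that is, two such graphs with the same values of $c_4$ and of $k_2\uplus k_2$ have the same value of $i_4$).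
   Context: All graphs are finite and simple. $i_t(G)$ denotes the number of independent sets of $G$ of size exactly $t$. For $J\subseteq V(G)$, $G[J]$ is the subgraph of $G$ induced by $J$. $k_3(G)$, $k_4(G)$, $c_4(G)$ and $(k_2\uplus k_2)(G)$ denote the number of subsets $J\subseteq V(G)$ such that the induced subgraph $G[J]$ is isomorphic to, respectively, the complete graph $K_3$, the complete graph $K_4$, the 4-cycle $C_4$, and $K_2\uplus K_2$ (the disjoint union of two single edges). *)

(* Defs.v *)
From mathcomp Require Import all_boot all_order all_algebra.

Set Implicit Arguments.
Unset Strict Implicit.
Unset Printing Implicit Defensive.

Record sgraph := SGraph {
  svertex :> finType;
  sedge : rel svertex;
  sedge_sym : symmetric sedge;
  sedge_irrefl : irreflexive sedge
}.

Definition degree (G : sgraph) (x : G) : nat := #|[set y : G | sedge x y]|.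

Definition regular (r : nat) (G : sgraph) : Prop := forall x : G, degree x = r.

Definition triangle_free (G : sgraph) : Prop :=
  forall x y z : G, ~ (sedge x y /\ sedge y z /\ sedge x z).

Definition independent (G : sgraph) (J : {set G}) : bool :=
  [forall x in J, forall y in J, ~~ sedge x y].

Definition num_indep (t : nat) (G : sgraph) : nat :=
  #|[set J : {set G} | (#|J| == t) && independent J]|.

Section Induced.
Variables (G : sgraph) (J : {set G}).

Definition induced_rel : rel {x : G | x \in J} :=
  fun u v => sedge (val u) (val v).

Lemma induced_sym : symmetric induced_rel.
Proof. by move=> u v; rewrite /induced_rel sedge_sym. Qed.

Lemma induced_irrefl : irreflexive induced_rel.
Proof. by move=> u; rewrite /induced_rel sedge_irrefl. Qed.

Definition induced : sgraph := SGraph induced_sym induced_irrefl.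

End Induced.

(* Isomorphism is made boolean, by searching the finitely many vertex maps, so
   that induced copies can be counted; isomorphicP is the usual definition. *)
Definition isomorphic (G H : sgraph) : bool :=
  [exists f : {ffun G -> H},
    [&& injectiveb f, [forall y, y \in codom f] &
        [forall x, forall y, sedge (f x) (f y) == sedge x y]]].

Lemma isomorphicP (G H : sgraph) :
  reflect (exists f : G -> H,
             bijective f /\ forall x y, sedge (f x) (f y) = sedge x y)
          (isomorphic G H).
Proof.
apply: (iffP existsP) => [[f /and3P[/injectiveP injf /forallP surjf eqf]]|].
  exists f; split; last by move=> x y; apply/eqP; move/forallP/(_ x)/forallP: eqf.
  exists (fun y => iinv (surjf y)) => [x|y]; last exact: f_iinv.
  by apply: injf; rewrite f_iinv.
case=> f [[g fK gK] eqf]; exists (finfun f); apply/and3P; split.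
- by apply/injectiveP=> x y; rewrite !ffunE; apply: (can_inj fK).
- by apply/forallP=> y; apply/codomP; exists (g y); rewrite ffunE gK.
- by apply/forallP=> x; apply/forallP=> y; rewrite !ffunE eqf.
Qed.

Definition num_induced (H G : sgraph) : nat :=
  #|[set J : {set G} | isomorphic (induced J) H]|.

Section Complete.
Variable m : nat.

Definition complete_rel : rel 'I_m := fun i j => i != j.

Lemma complete_sym : symmetric complete_rel.
Proof. by move=> i j; rewrite /complete_rel eq_sym. Qed.

Lemma complete_irrefl : irreflexive complete_rel.
Proof. by move=> i; rewrite /complete_rel eqxx. Qed.

Definition complete : sgraph := SGraph complete_sym complete_irrefl.

End Complete.

Definition cycle4_rel : rel 'I_4 :=
  fun i j => (j == i.+1 %% 4 :> nat) || (i == j.+1 %% 4 :> nat).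

Lemma cycle4_sym : symmetric cycle4_rel.
Proof. by move=> i j; rewrite /cycle4_rel orbC. Qed.

Lemma cycle4_irrefl : irreflexive cycle4_rel.
Proof. by case=> [[|[|[|[|i]]]]]. Qed.

Definition cycle4 : sgraph := SGraph cycle4_sym cycle4_irrefl.

Section DisjointUnion.
Variables G H : sgraph.

Definition disjoint_union_rel : rel (G + H)%type := fun u v =>
  match u, v with
  | inl x, inl y => sedge x y
  | inr x, inr y => sedge x y
  | _, _ => false
  end.

Lemma disjoint_union_sym : symmetric disjoint_union_rel.
Proof. by move=> [x|x] [y|y] //=; rewrite sedge_sym. Qed.

Lemma disjoint_union_irrefl : irreflexive disjoint_union_rel.
Proof. by move=> [x|x] /=; rewrite sedge_irrefl. Qed.

Definition disjoint_union : sgraph :=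
  SGraph disjoint_union_sym disjoint_union_irrefl.

End DisjointUnion.

Definition k3 (G : sgraph) : nat := num_induced (complete 3) G.
Definition k4 (G : sgraph) : nat := num_induced (complete 4) G.
Definition c4 (G : sgraph) : nat := num_induced cycle4 G.
Definition k2_k2 (G : sgraph) : nat :=
  num_induced (disjoint_union (complete 2) (complete 2)) G.

(* Main.v *)
Require Import Defs.
From mathcomp Require Import all_boot all_order all_algebra.
From mathcomp Require Import zify lra.

(** Both formulas are sums, over the vertex sets J of size t = 3 or 4, of an
    identity that holds for each J separately and involves only the degrees of
    the graph induced on J.

    On four vertices, a d-regular graph is unique up to isomorphism for each d:
    the empty graph for d = 0, two disjoint edges for d = 1, the 4-cycle for
    d = 2 and K4 for d = 3.  Hence i_4, k2_k2, c_4 and k_4 count the 4-sets J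
    inducing a 0-, 1-, 2- and 3-regular graph (isomorphic_complete,
    isomorphic_cycle4, isomorphic_K2_K2).  Write d(v) for the degree of v in
    G[J] and T for its number of triangles; every graph on four vertices
    satisfies
<<
      [0-regular] - [1-regular] + [2-regular] - [3-regular]
        = 1 - (1/2) sum_v d(v) + sum_v C(d(v), 2) - T - sum_v C(d(v), 3)
>>
    which is verified on the six possible edges (quadruple_identity).  The
    analogous identity on three vertices,
<<
      [0-regular] + [2-regular] = 1 - (1/2) sum_v d(v) + sum_v C(d(v), 2),
>>
    is triple_identity.

    Summation over J is a double count.  The sum of C(d(v), k) counts the stars
    with k leaves contained in J, and such a star lies in C(n-k-1, t-k-1) sets J
    (sum_bin_deg_in); an r-regular graph has n C(r, k) stars with a chosen
    centre.  A triangle lies in n - 3 sets of size four (sum_setD1).  Everything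
    is first stated in natural numbers, doubled and without subtraction of
    counts (num_indep3E, num_indep4E); the statements on triangle-free graphs
    follow at once, since k_3 and k_4 then vanish. *)

Set Implicit Arguments.
Unset Strict Implicit.
Unset Printing Implicit Defensive.
Import GRing.Theory.

(** * Degrees inside a vertex set *)

Definition deg_in (G : sgraph) (J : {set G}) (x : G) : nat :=
  #|[set y in J | sedge x y]|.

Definition regular_in (d : nat) (G : sgraph) (J : {set G}) : bool :=
  [forall x in J, deg_in J x == d].

Lemma deg_in_enum (G : sgraph) (J : {set G}) x :
  deg_in J x = count (sedge x) (enum J).
Proof.
rewrite /deg_in cardE -size_filter; congr size.
rewrite /enum_mem -filter_predI; apply: eq_filter => y.
by rewrite !inE /= andbC.
Qed.

Lemma regular_in_enum d (G : sgraph) (J : {set G}) :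
  regular_in d J = all (fun x => count (sedge x) (enum J) == d) (enum J).
Proof.
apply/forall_inP/allP => H x.
  by rewrite mem_enum => /H; rewrite deg_in_enum.
by move=> xJ; rewrite deg_in_enum H // mem_enum.
Qed.

Lemma deg_inD1 (G : sgraph) (J : {set G}) v x : v \in J ->
  deg_in J x = sedge x v + deg_in (J :\ v) x.
Proof.
move=> vJ; rewrite /deg_in (cardsD1 v) !inE vJ; congr (_ + #|pred_of_set _|).
by apply/setP => y; rewrite !inE andbA.
Qed.

(** The degrees inside J :\ v are expressed by those inside J, so that the
    triangles contained in a 4-set can be tested on the 4-set itself. *)
Lemma regular_inD1 d (G : sgraph) (J : {set G}) v : v \in J ->
  regular_in d (J :\ v) =
  all (fun x => (x == v) || (count (sedge x) (enum J) == sedge x v + d))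
      (enum J).
Proof.
move=> vJ; apply/forall_inP/allP => H x.
  rewrite mem_enum => xJ; case: eqVneq => //= xv.
  by rewrite -deg_in_enum (deg_inD1 _ vJ) eqn_add2l H // !inE xv.
rewrite !inE => /andP[xv xJ].
move: (H x); rewrite mem_enum xJ (negPf xv) -deg_in_enum (deg_inD1 _ vJ).
by rewrite eqn_add2l; apply.
Qed.

Lemma independent_regular_in (G : sgraph) (J : {set G}) :
  independent J = regular_in 0 J.
Proof.
apply: eq_forallb_in => x xJ; rewrite cards_eq0.
apply/forall_inP/eqP => [H|/setP H y yJ].
  by apply/setP => y; rewrite !inE; apply/negP => /andP[/H/negPf->].
by move: (H y); rewrite !inE yJ /= => ->.
Qed.

(** * Recognizing induced subgraphs by their degrees *)

Lemma isomorphic_regular_in d (G H : sgraph) (J : {set G}) :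
  regular d H -> isomorphic (induced J) H -> #|J| = #|H| /\ regular_in d J.
Proof.
move=> regH /isomorphicP[f [bijf ef]]; split.
  by rewrite -(bij_eq_card bijf) card_sig; apply: eq_card => x; rewrite inE.
have [g fK gK] := bijf.
apply/forall_inP => x xJ.
rewrite -(regH (f (Sub x xJ))) /degree /deg_in; apply/eqP.
have injvg : injective (fun h : H => val (g h)).
  by move=> h h' /val_inj /(can_inj gK).
rewrite -(card_imset _ injvg); apply: eq_card => y; rewrite !inE.
apply/andP/imsetP => [[yJ xy]|[h]].
  exists (f (Sub y yJ)); last by rewrite fK.
  by rewrite inE ef.
rewrite inE => xh ->; split; first exact: valP (g h).
by rewrite -[h]gK ef in xh.
Qed.

Lemma isomorphic_of_embedding (G H : sgraph) (J : {set G}) (g : H -> G) :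
  injective g -> (forall h, g h \in J) -> #|J| = #|H| ->
  (forall h h', sedge (g h) (g h') = sedge h h') ->
  isomorphic (induced J) H.
Proof.
move=> injg gJ cJ eg.
have injS : injective (fun h => Sub (g h) (gJ h) : induced J).
  by move=> h h' /(congr1 val) /injg.
have [|f fK gK] := inj_card_bij injS.
  by rewrite -cJ card_sig; apply: eq_leq; apply: eq_card => x; rewrite inE.
apply/isomorphicP; exists f; split; first by exists (fun h => Sub (g h) (gJ h)).
by move=> u v; rewrite -[u in RHS]gK -[v in RHS]gK -eg.
Qed.

Lemma regular_complete m : regular m.-1 (complete m).
Proof.
move=> x; rewrite /degree.
have -> : [set y | sedge x y] = [set~ x].
  by apply/setP => y; rewrite !inE /= /complete_rel eq_sym.
by rewrite cardsC1 card_ord.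
Qed.

(** A vertex of degree #|J| - 1 inside J is adjacent to all the others, so any
    enumeration of J is an isomorphism. *)
Lemma isomorphic_complete m (G : sgraph) (J : {set G}) :
  #|J| = m -> isomorphic (induced J) (complete m) = regular_in m.-1 J.
Proof.
move=> cJ; apply/idP/idP.
  by case/(isomorphic_regular_in (@regular_complete m)).
move=> /forall_inP rJ.
have clique x y : x \in J -> y \in J -> sedge x y = (x != y).
  move=> xJ yJ; case: eqVneq => [->|xy]; first by rewrite sedge_irrefl.
  have: [set z in J | sedge x z] == J :\ x.
    rewrite eqEcard; apply/andP; split.
      apply/subsetP => z; rewrite !inE => /andP[-> xz]; rewrite andbT.
      by apply: contraTneq xz => ->; rewrite sedge_irrefl.
    by move/eqP: (rJ x xJ); rewrite /deg_in => ->; rewrite -cJ (cardsD1 x J) xJ.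
  by move/eqP/setP/(_ y); rewrite !inE yJ eq_sym xy.
have cJm : m = #|J| by [].
have inJ (i : 'I_m) : enum_val (cast_ord cJm i) \in J by exact: enum_valP.
have inj : injective (fun i : 'I_m => enum_val (cast_ord cJm i)).
  by move=> i j /enum_val_inj /cast_ord_inj.
apply: (@isomorphic_of_embedding _ (complete m) _ _ inj inJ).
  by rewrite cJ card_ord.
by move=> i j; rewrite clique // (inj_eq inj).
Qed.

Lemma regular_cycle4 : regular 2 cycle4.
Proof.
move=> x; rewrite /degree -sum1dep_card big_mkcond /= !big_ord_recl big_ord0.
by case: x => [[|[|[|[|i]]]]].
Qed.

Lemma regular_K2_K2 : regular 1 (disjoint_union (complete 2) (complete 2)).
Proof.
move=> x; rewrite /degree -sum1dep_card big_mkcond /= big_sumType /=.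
rewrite !big_ord_recl !big_ord0.
by case: x => [[[|[|i]]]|[[|[|i]]]].
Qed.

Lemma isomorphic_cycle4_intro (G : sgraph) (J : {set G}) p q r s :
  perm_eq [:: p; q; r; s] (enum J) ->
  [/\ sedge p q, sedge q r, sedge r s & sedge p s] ->
  ~~ sedge p r -> ~~ sedge q s ->
  isomorphic (induced J) cycle4.
Proof.
move=> eJ; have us: uniq [:: p; q; r; s] by rewrite (perm_uniq eJ) enum_uniq.
have sJ x : x \in [:: p; q; r; s] -> x \in J by rewrite (perm_mem eJ) mem_enum.
have cJ : #|J| = 4 by rewrite cardE -(perm_size eJ).
move=> [pq qr rs ps] /negPf pr /negPf qs.
pose g (i : 'I_4) := nth p [:: p; q; r; s] i.
apply: (@isomorphic_of_embedding _ cycle4 _ g).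
- by move=> i j /eqP; rewrite nth_uniq // => /eqP/val_inj.
- by move=> i; apply/sJ/mem_nth.
- by rewrite cJ card_ord.
by move=> [[|[|[|[|i]]]] // ?] [[|[|[|[|j]]]] // ?];
  rewrite /g /= ?sedge_irrefl // ?[sedge q p]sedge_sym ?[sedge r p]sedge_sym
    ?[sedge s p]sedge_sym ?[sedge r q]sedge_sym ?[sedge s q]sedge_sym
    ?[sedge s r]sedge_sym ?pq ?qr ?rs ?ps ?pr ?qs.
Qed.

Lemma isomorphic_K2_K2_intro (G : sgraph) (J : {set G}) p q r s :
  perm_eq [:: p; q; r; s] (enum J) ->
  sedge p q -> sedge r s ->
  [/\ ~~ sedge p r, ~~ sedge p s, ~~ sedge q r & ~~ sedge q s] ->
  isomorphic (induced J) (disjoint_union (complete 2) (complete 2)).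
Proof.
move=> eJ; have us: uniq [:: p; q; r; s] by rewrite (perm_uniq eJ) enum_uniq.
have sJ x : x \in [:: p; q; r; s] -> x \in J by rewrite (perm_mem eJ) mem_enum.
have cJ : #|J| = 4 by rewrite cardE -(perm_size eJ).
move=> pq rs [/negPf pr /negPf ps /negPf qr /negPf qs].
pose k (h : 'I_2 + 'I_2) : nat :=
  match h with inl i => i | inr i => i.+2 end.
have k4 h : k h < 4 by case: h => [[[|[|i]]]|[[|[|i]]]].
apply: (@isomorphic_of_embedding _
  (disjoint_union (complete 2) (complete 2)) _
  (fun h => nth p [:: p; q; r; s] (k h))).
- move=> h h' /eqP; rewrite nth_uniq ?k4 // => /eqP.
  case: h h' => i [] j; rewrite /k.
  + by move/val_inj->.
  + by move=> E; have := ltn_ord i; rewrite E.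
  + by move=> E; have := ltn_ord j; rewrite -E.
  + by case=> /val_inj->.
- by move=> i; apply/sJ/mem_nth/k4.
- by rewrite cJ card_sum !card_ord.
by move=> [[[|[|i]] // ?]|[[|[|i]] // ?]] [[[|[|j]] // ?]|[[|[|j]] // ?]];
  rewrite /= ?sedge_irrefl // ?[sedge q p]sedge_sym ?[sedge r p]sedge_sym
    ?[sedge s p]sedge_sym ?[sedge r q]sedge_sym ?[sedge s q]sedge_sym
    ?[sedge s r]sedge_sym ?pq ?qr ?rs ?ps ?pr ?qs.
Qed.

Lemma enum4 (T : finType) (J : {set T}) : #|J| = 4 ->
  exists a b c d, enum J = [:: a; b; c; d].
Proof.
rewrite cardE; case: (enum J) => [|a [|b [|c [|d [|]]]]] // _.
by exists a, b, c, d.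
Qed.


(** In a 2-regular graph on four vertices each vertex has exactly one
    non-neighbour.  The three cases left are the possible non-neighbours of a;
    each fixes a cyclic order of the vertices. *)
Lemma isomorphic_cycle4 (G : sgraph) (J : {set G}) :
  #|J| = 4 -> isomorphic (induced J) cycle4 = regular_in 2 J.
Proof.
move=> cJ; apply/idP/idP; first by case/(isomorphic_regular_in regular_cycle4).
have [a [b [c [d eJ]]]] := enum4 cJ.
rewrite regular_in_enum eJ /= !sedge_irrefl.
rewrite [sedge b a]sedge_sym [sedge c a]sedge_sym [sedge d a]sedge_sym.
rewrite [sedge c b]sedge_sym [sedge d b]sedge_sym [sedge d c]sedge_sym.
case ab : (sedge a b); case ac : (sedge a c); case ad : (sedge a d);
  case bc : (sedge b c); case bd : (sedge b d); case cd : (sedge c d) => // _.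
- apply: (@isomorphic_cycle4_intro _ _ a b d c);
    rewrite ?eJ ?[sedge d c]sedge_sym ?ab ?ac ?ad ?bc ?bd ?cd //.
  by apply/permP => P /=; lia.
- apply: (@isomorphic_cycle4_intro _ _ a b c d);
    by rewrite ?eJ ?ab ?ac ?ad ?bc ?bd ?cd.
- apply: (@isomorphic_cycle4_intro _ _ a c b d);
    rewrite ?eJ ?[sedge c b]sedge_sym ?ab ?ac ?ad ?bc ?bd ?cd //.
  by apply/permP => P /=; lia.
Qed.

(** The three cases left are the possible neighbours of a in a perfect
    matching. *)
Lemma isomorphic_K2_K2 (G : sgraph) (J : {set G}) :
  #|J| = 4 ->
  isomorphic (induced J) (disjoint_union (complete 2) (complete 2)) =
  regular_in 1 J.
Proof.
move=> cJ; apply/idP/idP; first by case/(isomorphic_regular_in regular_K2_K2).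
have [a [b [c [d eJ]]]] := enum4 cJ.
rewrite regular_in_enum eJ /= !sedge_irrefl.
rewrite [sedge b a]sedge_sym [sedge c a]sedge_sym [sedge d a]sedge_sym.
rewrite [sedge c b]sedge_sym [sedge d b]sedge_sym [sedge d c]sedge_sym.
case ab : (sedge a b); case ac : (sedge a c); case ad : (sedge a d);
  case bc : (sedge b c); case bd : (sedge b d); case cd : (sedge c d) => // _.
- apply: (@isomorphic_K2_K2_intro _ _ a b c d);
    by rewrite ?eJ ?ab ?ac ?ad ?bc ?bd ?cd.
- apply: (@isomorphic_K2_K2_intro _ _ a c b d);
    rewrite ?eJ ?[sedge c b]sedge_sym ?ab ?ac ?ad ?bc ?bd ?cd //.
  by apply/permP => P /=; lia.
- apply: (@isomorphic_K2_K2_intro _ _ a d b c);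
    rewrite ?eJ ?[sedge d b]sedge_sym ?[sedge d c]sedge_sym
      ?ab ?ac ?ad ?bc ?bd ?cd //.
  by apply/permP => P /=; lia.
Qed.

(** * The counts as sums over vertex sets of a given size *)

Lemma num_indepE t (G : sgraph) :
  num_indep t G = \sum_(J : {set G} | #|J| == t) regular_in 0 J.
Proof.
rewrite /num_indep -sum1dep_card big_mkcondr; apply: eq_bigr => J _.
by rewrite independent_regular_in; case: regular_in.
Qed.

Lemma num_inducedE t d (G H : sgraph) :
  #|H| = t -> regular d H ->
  (forall J : {set G}, #|J| = t -> isomorphic (induced J) H = regular_in d J) ->
  num_induced H G = \sum_(J : {set G} | #|J| == t) regular_in d J.
Proof.
move=> cH regH iso; rewrite /num_induced.
have -> : [set J : {set G} | isomorphic (induced J) H] =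
          [set J : {set G} | (#|J| == t) && regular_in d J].
  apply/setP => J; rewrite !inE; case: eqP => [/iso //|nt].
  by apply: contra_notF nt => /(isomorphic_regular_in regH)[->].
rewrite -sum1dep_card big_mkcondr; apply: eq_bigr => J _.
by case: regular_in.
Qed.

Lemma num_completeE m (G : sgraph) :
  num_induced (complete m) G =
  \sum_(J : {set G} | #|J| == m) regular_in m.-1 J.
Proof.
apply: num_inducedE (@regular_complete m) _; first by rewrite card_ord.
exact: isomorphic_complete.
Qed.

Lemma c4E (G : sgraph) :
  c4 G = \sum_(J : {set G} | #|J| == 4) regular_in 2 J.
Proof.
apply: num_inducedE regular_cycle4 _; first by rewrite card_ord.
exact: isomorphic_cycle4.
Qed.

Lemma k2_k2E (G : sgraph) :
  k2_k2 G = \sum_(J : {set G} | #|J| == 4) regular_in 1 J.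
Proof.
apply: num_inducedE regular_K2_K2 _; first by rewrite card_sum !card_ord.
exact: isomorphic_K2_K2.
Qed.


(** * Double counting *)

Lemma card_supersets (T : finType) (A : {set T}) t : #|A| <= t ->
  #|[set J : {set T} | (#|J| == t) && (A \subset J)]| =
  'C(#|T| - #|A|, t - #|A|).
Proof.
move=> leAt; have -> : #|T| - #|A| = #|~: A| by rewrite -(cardsC A) addKn.
rewrite -cards_draws.
set D := [set B : {set T} | B \subset _ & _].
have DA B : B \in D -> (A :|: B) :\: A = B.
  by rewrite inE setDUl setDv set0U setDE => /andP[BA _]; exact/setIidPl.
rewrite -(@card_in_imset _ _ (setU A) D); last first.
  by move=> B C /DA {2}<- /DA {2}<- /= ->.
apply: eq_card => J; rewrite inE; apply/andP/imsetP => [[/eqP cJ AJ]|[B BD ->]].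
  exists (J :\: A); last by rewrite -[LHS](setID J A) (setIidPr AJ).
  by rewrite inE subsetDr -cJ cardsD (setIidPr AJ) eqxx.
split; last exact: subsetUl.
move: (BD); rewrite inE => /andP[_ /eqP cB].
by rewrite -(cardsID A (A :|: B)) DA // (setIidPr (subsetUl A B)) cB subnKC.
Qed.

(** Double counting of the pairs of a set J and a star with k leaves, centred at
    v, contained in J. *)
Lemma sum_bin_deg_in (G : sgraph) t k : k < t ->
  \sum_(J : {set G} | #|J| == t) \sum_(v in J) 'C(deg_in J v, k) =
  (\sum_(v : G) 'C(degree v, k)) * 'C(#|G| - k.+1, t - k.+1).
Proof.
move=> ltkt.
pose N v := [set y : G | sedge v y].
have binE (J : {set G}) v :
    'C(deg_in J v, k) =
    \sum_(B : {set G} | (B \subset N v) && (#|B| == k)) (B \subset J).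
  have -> : deg_in J v = #|J :&: N v| by apply: eq_card => y; rewrite !inE.
  rewrite -cards_draws -sum1dep_card big_mkcond [RHS]big_mkcond.
  by apply: eq_bigr => B _; rewrite subsetI; do !case: (_ \subset _); case: eqP.
transitivity (\sum_(v : G) \sum_(B : {set G} | (B \subset N v) && (#|B| == k))
    \sum_(J : {set G} | #|J| == t) ((v |: B) \subset J)).
  rewrite (eq_bigr (fun J : {set G} => \sum_v
    \sum_(B : {set G} | (B \subset N v) && (#|B| == k)) ((v |: B) \subset J))).
    by rewrite exchange_big; apply: eq_bigr => v _; rewrite exchange_big.
  move=> J _; rewrite big_mkcond; apply: eq_bigr => v _.
  rewrite binE; case: ifP => vJ.
    by apply: eq_bigr => B _; rewrite subUset sub1set vJ.
  by rewrite big1 // => B _; rewrite subUset sub1set vJ.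
rewrite big_distrl; apply: eq_bigr => v _ /=.
rewrite -[degree v]/#|N v| -cards_draws -sum1dep_card big_distrl.
apply: eq_bigr => B /andP[BN /eqP cB] /=.
have cvB : #|v |: B| = k.+1.
  rewrite cardsU1 cB; case: (boolP (v \in B)) => // /(subsetP BN).
  by rewrite inE sedge_irrefl.
rewrite mul1n -cvB -card_supersets ?cvB // -sum1dep_card [RHS]big_mkcondr.
by apply: eq_bigr => J _; case: (_ \subset _).
Qed.

(** Double counting of the pairs (A, J) with J obtained from A by adding one of
    the #|T| - t elements outside A. *)
Lemma sum_setD1 (T : finType) (F : {set T} -> nat) t :
  \sum_(J : {set T} | #|J| == t.+1) \sum_(v in J) F (J :\ v) =
  (#|T| - t) * \sum_(A : {set T} | #|A| == t) F A.
Proof.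
rewrite (exchange_big_dep xpredT) //=.
transitivity (\sum_v \sum_(A : {set T} | (#|A| == t) && (v \notin A)) F A).
  apply: eq_bigr => v _.
  rewrite (reindex_onto (setU [set v]) (fun J => J :\ v)) => [|J /andP[_ vJ]];
    last exact: setD1K.
  apply: eq_big => A; last by move=> /andP[_ /eqP->].
  rewrite setU11 andbT cardsU1; case: (boolP (v \in A)) => vA.
    rewrite andbF; apply: contraTF vA => /andP[_ /eqP <-].
    by rewrite !inE eqxx.
  by rewrite setU1K // eqxx add1n eqSS.
rewrite (exchange_big_dep (fun A : {set T} => #|A| == t)) /=;
  last by move=> v A _ /andP[].
rewrite big_distrr; apply: eq_bigr => A cA /=.
rewrite (eq_bigl (fun v => v \in ~: A)) => [|v]; last by rewrite cA inE.
by rewrite sum_nat_const -(eqP cA) -(cardsC A) addKn.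
Qed.

(** * The identities on three and four vertices *)

Lemma triple_identity (G : sgraph) (J : {set G}) : #|J| = 3 ->
  2 * regular_in 0 J + \sum_(v in J) 'C(deg_in J v, 1) + 2 * regular_in 2 J =
  2 + 2 * \sum_(v in J) 'C(deg_in J v, 2).
Proof.
move=> cJ; rewrite -!big_enum /= !regular_in_enum.
under eq_bigr do rewrite deg_in_enum.
under [in RHS]eq_bigr do rewrite deg_in_enum.
rewrite cardE in cJ.
case: (enum J) cJ => [|a [|b [|c [|]]]] // _.
rewrite !big_cons !big_nil /= !sedge_irrefl.
rewrite [sedge b a]sedge_sym [sedge c a]sedge_sym [sedge c b]sedge_sym.
by case: (sedge a b); case: (sedge a c); case: (sedge b c).
Qed.

(** The sign-alternating identity of the introduction, doubled, with the
    negative terms moved across.  The sum over J :\ v is the number of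
    triangles in J. *)
Lemma quadruple_identity (G : sgraph) (J : {set G}) : #|J| = 4 ->
  2 * regular_in 0 J + \sum_(v in J) 'C(deg_in J v, 1)
    + 2 * (\sum_(v in J) regular_in 2 (J :\ v))
    + 2 * (\sum_(v in J) 'C(deg_in J v, 3)) + 2 * regular_in 2 J =
  2 * regular_in 3 J + 2 + 2 * (\sum_(v in J) 'C(deg_in J v, 2))
    + 2 * regular_in 1 J.
Proof.
move=> cJ.
have E k : \sum_(v in J) 'C(deg_in J v, k) =
           \sum_(v <- enum J) 'C(count (sedge v) (enum J), k).
  by rewrite -big_enum; under eq_bigr do rewrite deg_in_enum.
rewrite !E (eq_bigr _ (fun v vJ => congr1 nat_of_bool (regular_inD1 2 vJ))).
rewrite !regular_in_enum -big_enum /=.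
have [a [b [c [d eJ]]]] := enum4 cJ.
have := enum_uniq J; rewrite eJ /= !inE !negb_or.
case/and4P=> /and3P[/negPf ab /negPf ac /negPf ad].
move=> /andP[/negPf bc /negPf bd] /negPf cd _.
rewrite !big_cons !big_nil /= !sedge_irrefl.
rewrite [sedge b a]sedge_sym [sedge c a]sedge_sym [sedge d a]sedge_sym.
rewrite [sedge c b]sedge_sym [sedge d b]sedge_sym [sedge d c]sedge_sym.
rewrite !eqxx ![b == a]eq_sym ![c == a]eq_sym ![d == a]eq_sym.
rewrite ![c == b]eq_sym ![d == b]eq_sym ![d == c]eq_sym ab ac ad bc bd cd.
by case: (sedge a b); case: (sedge a c); case: (sedge a d);
  case: (sedge b c); case: (sedge b d); case: (sedge c d).
Qed.

(** * Summation over a regular graph *)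

Lemma sum_bin_degree (G : sgraph) r k : regular r G ->
  \sum_(v : G) 'C(degree v, k) = #|G| * 'C(r, k).
Proof.
by move=> rG; rewrite -sum_nat_const; apply: eq_bigr => v _; rewrite rG.
Qed.

Lemma num_indep3E (G : sgraph) r : regular r G ->
  2 * num_indep 3 G + #|G| * r * 'C(#|G| - 2, 1) + 2 * k3 G =
  2 * 'C(#|G|, 3) + 2 * (#|G| * 'C(r, 2)).
Proof.
move=> rG; rewrite /k3 num_completeE num_indepE -card_draws -sum1dep_card.
have := sum_bin_deg_in G (isT : 1 < 3); have := sum_bin_deg_in G (isT : 2 < 3).
rewrite !(sum_bin_degree _ rG) bin1 bin0 muln1 => <- <-.
rewrite !big_distrr -!big_split /=.
by apply: eq_bigr => J /eqP cJ; rewrite muln1 triple_identity.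
Qed.

Lemma num_indep4E (G : sgraph) r : regular r G ->
  2 * num_indep 4 G + #|G| * r * 'C(#|G| - 2, 2) + 2 * ((#|G| - 3) * k3 G)
    + 2 * (#|G| * 'C(r, 3)) + 2 * c4 G =
  2 * k4 G + 2 * 'C(#|G|, 4) + 2 * (#|G| * 'C(r, 2) * (#|G| - 3)) + 2 * k2_k2 G.
Proof.
move=> rG; rewrite c4E k2_k2E /k3 /k4 !num_completeE num_indepE.
rewrite -card_draws -sum1dep_card -sum_setD1.
have := sum_bin_deg_in G (isT : 1 < 4); have := sum_bin_deg_in G (isT : 2 < 4).
have := sum_bin_deg_in G (isT : 3 < 4).
rewrite !(sum_bin_degree _ rG) bin0 muln1 !bin1 => <- <- <-.
rewrite !big_distrr -!big_split /=.
by apply: eq_bigr => J /eqP cJ; rewrite muln1 quadruple_identity.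
Qed.

Lemma triangle_free_complete m (G : sgraph) :
  triangle_free G -> num_induced (complete m.+3) G = 0.
Proof.
move=> tfG; apply/eqP; rewrite cards_eq0; apply/eqP/setP => J; rewrite !inE.
apply/isomorphicP => -[f [[g _ gK] ef]].
have eg (i j : complete m.+3) : i != j -> sedge (val (g i)) (val (g j)).
  by move=> ij; rewrite -[sedge _ _]/(sedge (g i) (g j)) -ef !gK.
by apply: (tfG (val (g (inord 0))) (val (g (inord 1))) (val (g (inord 2))));
  do !split; apply: eg; rewrite -val_eqE /= !inordK.
Qed.

Lemma degree_lt (G : sgraph) (x : G) : degree x < #|G|.
Proof.
rewrite -cardsT /degree; apply/proper_card/properP; split; first exact: subsetT.
by exists x; rewrite !inE // sedge_irrefl.
Qed.

(** Degrees are smaller than #|G|.  For small graphs this annihilates the terms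
    whose other factor is a truncated difference. *)
Lemma regular_bin_eq0 (G : sgraph) r k :
  regular r G -> #|G| <= k -> #|G| * 'C(r, k) = 0.
Proof.
move=> rG leGk; case: (pickP (mem G)) => [x _|/eq_card0->] //.
by rewrite bin_small ?muln0 // -(rG x) (leq_trans (degree_lt x)).
Qed.

Lemma num_complete_eq0 (G : sgraph) m :
  #|G| < m -> num_induced (complete m) G = 0.
Proof.
move=> ltGm; rewrite num_completeE big_pred0 // => J.
by apply: ltn_eqF; apply: leq_ltn_trans (max_card _) ltGm.
Qed.

Local Open Scope ring_scope.

Lemma natrBM (R : pzRingType) m k x : (m < k -> x = 0)%N ->
  ((m - k) * x)%N%:R = (m%:R - k%:R) * x%:R :> R.
Proof.
rewrite natrM; have [_ /(_ isT)->|/natrB->//] := ltnP m k.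
by rewrite !mulr0.
Qed.

(* In 'C(n - 2, 2) the subtraction is truncated; this only matters for n < 2,
   where an r-regular graph on n vertices has n * r = 0. *)
Theorem corollary2p3 (n r : nat) :
  (forall G : sgraph, #|G| = n -> regular r G ->
     (num_indep 3 G)%:R + (k3 G)%:R =
       'C(n, 3)%:R - (n%:R - 2) * (n%:R * r%:R / 2) + n%:R * 'C(r, 2)%:R
       :> rat
     /\
     (num_indep 4 G)%:R - (k4 G)%:R =
       'C(n, 4)%:R - 'C(n - 2, 2)%:R * (n%:R * r%:R / 2)
       + (n%:R - 3) * (n%:R * 'C(r, 2)%:R - (k3 G)%:R)
       - n%:R * 'C(r, 3)%:R + (k2_k2 G)%:R - (c4 G)%:R
       :> rat)
  /\
  (forall G1 G2 : sgraph,
     #|G1| = n -> regular r G1 -> triangle_free G1 ->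
     #|G2| = n -> regular r G2 -> triangle_free G2 ->
     num_indep 3 G1 = num_indep 3 G2)
  /\
  (forall G1 G2 : sgraph,
     #|G1| = n -> regular r G1 -> triangle_free G1 ->
     #|G2| = n -> regular r G2 -> triangle_free G2 ->
     c4 G1 = c4 G2 -> k2_k2 G1 = k2_k2 G2 ->
     num_indep 4 G1 = num_indep 4 G2).
Proof.
split; last first.
  split=> G1 G2 c1 r1 t1 c2 r2 t2.
    have := num_indep3E r1; have := num_indep3E r2.
    by rewrite /k3 !triangle_free_complete // c1 c2; lia.
  move=> c4E k2E; have := num_indep4E r1; have := num_indep4E r2.
  by rewrite /k3 /k4 !triangle_free_complete // c1 c2 c4E k2E; lia.
move=> G cG rG.
(* For small n the truncated differences n - 2 and n - 3 multiply 0. *)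
have nr0 : (n < 2 -> n * r = 0)%N.
  by rewrite -cG -[X in (_ * X)%N]bin1; apply: regular_bin_eq0.
have nr20 : (n < 3 -> n * 'C(r, 2) = 0)%N.
  by rewrite -cG; apply: regular_bin_eq0.
have k30 : (n < 3 -> k3 G = 0)%N by rewrite -cG; apply: num_complete_eq0.
split.
  have /(congr1 (fun m => m%:R : rat)) := num_indep3E rG.
  rewrite cG bin1 [(n * r * _)%N]mulnC.
  by rewrite !natrD natrBM // !natrM; lra.
have /(congr1 (fun m => m%:R : rat)) := num_indep4E rG.
rewrite cG [(_ * (n - 3))%N]mulnC.
by rewrite !(natrD, natrM _ 2) !natrBM // !natrM; lra.
Qed.
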